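(* Let $0\le k\le l\le n$ be integers. Then $$L_J^\circ\cdot I_{k,l}=\mathcal P_{\geq 0}\cap\tilde R_{k,l}.$$
   Context: Let $n\ge1$, $e_1,\dots,e_{2n}$ the standard basis of $\mathbb R^{2n}$, and $G=Sp_{2n}(\mathbb R)$ for the symplectic form $\begin{bmatrix}0&I_n\\-I_n&0\end{bmatrix}$. $P_J^+$ (resp. $P_J^-$) is the subgroup of $G$ of matrices with zero lower left (resp. upper right) $n\times n$ block, and $L_J^\circ=\{\mathrm{diag}(A,(A^t)^{-1}):A\in GL_n(\mathbb R),\det A>0\}$. $\mathcal P=G/P_J^+$ is identified with the Lagrangian Grassmannian via $gP_J^+\mapsto g\,\mathrm{span}(e_1,\dots,e_n)$; a point is written $\begin{bmatrix}A\\C\end{bmatrix}$ (column span of a rank $n$ matrix with $n\times n$ blocks $A,C$, $A^tC=C^tA$). $\mathcal P_{\ge0}=\{\begin{bmatrix}A\\C\end{bmatrix}\in\mathcal P: A^tC\text{ positive semi-definite}\}$. The Weyl group $W$ of $G$ (with respect to the diagonal torus) is identified with the group of permutations $\sigma$ of $\{\pm1,\dots,\pm n\}$ with $\sigma(-i)=-\sigma(i)$: a lift $\dot w$ of $w$ satisfies $\dot w e_i=\pm e_{w(i)}$, where $e_{-k}:=e_{n+k}$. Let $s_i$ ($1\le i\le n-1$) be the element exchanging $i$ and $i+1$ (and $-i$, $-(i+1)$), and $t$ the element exchanging $n$ and $-n$. Put $x_0=e$, $x_1=t$, $x_{i+1}=ts_{n-1}s_{n-2}\cdots s_{n-i}x_i$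 for $1\le i\le n-1$. Define $$\tilde R_{k,l}=P_J^+\dot x_l\cdot P_J^+\cap P_J^-\dot x_k\cdot P_J^+\subseteq\mathcal P,$$ where $\cdot P_J^+$ denotes the image in $\mathcal P=G/P_J^+$. Let $I_m^+=\mathrm{diag}(1,\dots,1,0,\dots,0)$ and $I_m^-=\mathrm{diag}(0,\dots,0,1,\dots,1)$ be the $n\times n$ matrices with exactly $m$ ones, and $I_{k,l}=\begin{bmatrix}I_{n-k}^+\\ I_l^-\end{bmatrix}\in\mathcal P$. *)

(* Defs.v *)
From mathcomp Require Import all_boot all_order all_algebra all_fingroup.
From mathcomp Require Import classical_sets reals.

Set Implicit Arguments.
Unset Strict Implicit.
Unset Printing Implicit Defensive.

Import Order.TTheory GRing.Theory Num.Theory.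
Local Open Scope classical_set_scope.
Local Open Scope ring_scope.

Section SignedPermutations.
Variable n : nat.

(* The 0-based index i < n of 'I_(n + n) stands for i + 1 and the index n + i
   for -(i + 1), following e_{-k} = e_{n+k}. *)
Definition negi (i : 'I_(n + n)) : 'I_(n + n) :=
  match split i with inl a => rshift n a | inr a => lshift n a end.

Definition weyl : set 'S_(n + n) :=
  [set w | forall i, w (negi i) = negi (w i)].

(* s_i and t use the 1-based numbering; they are the identity when the indices
   they should exchange are out of range. *)
Definition s_ (i : nat) : 'S_(n + n) :=
  match (insub i.-1 : option 'I_n), (insub i : option 'I_n) with
  | Some a, Some b =>
      (tperm (lshift n a) (lshift n b) * tperm (rshift n a) (rshift n b))%g
  | _, _ => 1%g
  end.

Definition t_ : 'S_(n + n) :=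
  if (insub n.-1 : option 'I_n) is Some a then tperm (lshift n a) (rshift n a)
  else 1%g.

(* In perm, (u * v) i = v (u i), whereas the product
   x_{i+1} = t s_{n-1} ... s_{n-i} x_i is a composition of maps, the rightmost
   factor acting first; hence the reversed order of the factors. For i = 0 the
   range is empty and x_1 = t. *)
Fixpoint x_ (i : nat) : 'S_(n + n) :=
  if i is i'.+1 then (x_ i' * \prod_(n - i' <= j < n) s_ j * t_)%g else 1%g.

Lemma negiK : involutive negi.
Proof.
move=> i; rewrite /negi; case: (split_ordP i) => a ->.
  by rewrite (unsplitK (inr a)).
by rewrite (unsplitK (inl a)).
Qed.

Lemma negi_lshift (a : 'I_n) : negi (lshift n a) = rshift n a.
Proof. by rewrite /negi (unsplitK (inl a)). Qed.

Lemma negi_rshift (a : 'I_n) : negi (rshift n a) = lshift n a.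
Proof. by rewrite /negi (unsplitK (inr a)). Qed.

Lemma weyl1 : weyl 1%g.
Proof. by move=> i; rewrite !perm1. Qed.

Lemma weylM (u v : 'S_(n + n)) : weyl u -> weyl v -> weyl (u * v)%g.
Proof. by move=> hu hv i; rewrite !permM hu hv. Qed.

Lemma weyl_s (i : nat) : weyl (s_ i).
Proof.
rewrite /s_; case: insub => [a|]; last exact: weyl1.
case: insub => [b|]; last exact: weyl1.
have /permP cab : (tperm (lshift n a) (lshift n b) * tperm (rshift n a) (rshift n b)
    = tperm (rshift n a) (rshift n b) * tperm (lshift n a) (lshift n b))%g.
  by rewrite [LHS]conjgC tpermJ !tpermD // eq_rlshift.
move=> j; rewrite {}cab !permM -!negi_lshift (inj_tperm _ _ _ (inv_inj negiK)).
by rewrite !negiK -(inj_tperm _ _ _ (inv_inj negiK)).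
Qed.

Lemma weyl_t : weyl t_.
Proof.
rewrite /t_; case: insub => [a|]; last exact: weyl1.
move=> j; rewrite (inj_tperm _ _ _ (inv_inj negiK)).
by rewrite negi_lshift negi_rshift tpermC.
Qed.

Lemma weyl_x (i : nat) : weyl (x_ i).
Proof.
elim: i => [|i IHi] /=; first exact: weyl1.
apply: weylM weyl_t; apply: weylM => //.
by apply: (big_ind weyl) => // [|u v|j _]; [exact: weyl1|exact: weylM|exact: weyl_s].
Qed.

End SignedPermutations.

Section Symplectic.
Variables (R : realType) (n : nat).
Local Notation mat := 'M[R]_(n + n).
Local Notation subspace := {vspace 'cV[R]_(n + n)}.

Definition J : mat := block_mx 0 1%:M (- 1%:M) 0.

Definition Sp : set mat := [set g | g^T *m J *m g = J].

Definition PJp : set mat := [set g | Sp g /\ dlsubmx g = 0].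

Definition PJm : set mat := [set g | Sp g /\ ursubmx g = 0].

Definition LJo : set mat :=
  [set block_mx A 0 0 (invmx A^T) | A in [set A : 'M[R]_n | 0 < \det A]].

Definition colspan (m : nat) (M : 'M[R]_(n + n, m)) : subspace :=
  <<[seq col j M | j : 'I_m]>>%VS.

Definition actLG (g : mat) (U : subspace) : subspace :=
  (linfun (mulmx g) @: U)%VS.

(* The Lagrangian Grassmannian, identified with Sp / PJp by [cosetP]. *)
Definition LGr : set subspace :=
  [set U | \dim U = n /\
           forall u v, u \in U -> v \in U -> u^T *m J *m v = 0].

Definition cosetP (g : mat) : subspace := actLG g (colspan (col_mx 1%:M 0)).

Definition psd (M : 'M[R]_n) : Prop :=
  M^T = M /\ forall x : 'cV[R]_n, 0 <= (x^T *m M *m x) 0 0.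

Definition LGr_ge0 : set subspace :=
  [set U | LGr U /\ exists A C : 'M[R]_n,
     U = colspan (col_mx A C) /\ psd (A^T *m C)].

Definition lift_of (w : 'S_(n + n)) : set mat :=
  [set g | Sp g /\
     forall i, exists b : bool, col i g = (-1) ^+ b *: delta_mx (w i) 0].

Lemma lift_of_exists (w : 'S_(n + n)) : weyl w -> exists g, lift_of w g.
Proof.
move=> hw.
pose sg (i : 'I_(n + n)) : R := (-1) ^+ (n <= i)%N.
have JE i j : J i j = sg i *+ (j == negi i).
  case: (split_ordP i) => a ->; case: (split_ordP j) => b ->;
    rewrite ?negi_lshift ?negi_rshift /J ?block_mxEul ?block_mxEur
      ?block_mxEdl ?block_mxEdr !mxE ?eq_lrshift ?eq_rlshift
      ?eq_rshift ?eq_lshift ?mulr0n // /sg /=.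
    by rewrite leqNgt ltn_ord eq_sym.
  by rewrite leq_addr expr1 eq_sym mulNrn.
pose b (i : 'I_(n + n)) := (n <= i)%N && ~~ (n <= w i)%N.
pose g : mat := \matrix_(p, i) ((-1) ^+ b i *+ (p == w i)).
exists g; split; last first.
  move=> i; exists (b i); apply/colP => p.
  by rewrite !mxE eqxx andbT mulr_natr.
have gE p i : g p i = (-1) ^+ b i *+ (p == w i) by rewrite mxE.
apply/matrixP => i j; rewrite JE mxE (bigD1 (w j)) //= big1 ?addr0; last first.
  by move=> p /negPf hp; rewrite gE hp mulr0.
rewrite gE eqxx mxE (bigD1 (w i)) //= big1 ?addr0; last first.
  by move=> p /negPf hp; rewrite [g^T _ _]mxE gE hp mul0r.
rewrite [g^T _ _]mxE gE eqxx JE -hw (inj_eq perm_inj).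
case: eqP => [->|_]; last by rewrite !mulr0n mulr0 mul0r.
rewrite !mulr1n /b hw.
have hn : (n <= negi i)%N = ~~ (n <= i)%N.
  case: (split_ordP i) => a ->; rewrite ?negi_lshift ?negi_rshift /=;
  by rewrite leq_addr leqNgt ltn_ord.
have hnw : (n <= negi (w i))%N = ~~ (n <= w i)%N.
  case: (split_ordP (w i)) => a ->; rewrite ?negi_lshift ?negi_rshift /=;
  by rewrite leq_addr leqNgt ltn_ord.
rewrite /sg hn hnw.
by case: (n <= i)%N; case: (n <= w i)%N; rewrite ?expr0 ?expr1 ?mulN1r ?mulrN1 ?mulr1 ?opprK.
Qed.

(* The arguments dxk and dxl are lifts of x_k and x_l. *)
Definition Rtilde (dxk dxl : mat) : set subspace :=
  [set cosetP (p *m dxl) | p in PJp] `&` [set cosetP (p *m dxk) | p in PJm].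

Definition Ip (m : nat) : 'M[R]_n := diag_mx (\row_(i < n) (i < m)%N%:R).

Definition Im (m : nat) : 'M[R]_n := diag_mx (\row_(i < n) (n - m <= i)%N%:R).

Definition Ikl (k l : nat) : subspace := colspan (col_mx (Ip (n - k)) (Im l)).

End Symplectic.

Arguments LJo : clear implicits.
Arguments LGr : clear implicits.
Arguments LGr_ge0 : clear implicits.
Arguments Ikl : clear implicits.

(* Main.v *)
Require Import Defs.
From mathcomp Require Import all_boot all_order all_algebra all_fingroup.
From mathcomp Require Import classical_sets reals.
From mathcomp Require Import zify.
Local Open Scope classical_set_scope.
Local Open Scope ring_scope.

Set Implicit Arguments.
Unset Strict Implicit.
Unset Printing Implicit Defensive.
Import Order.TTheory GRing.Theory Num.Theory.

(** Write a point of the Lagrangian Grassmannian as [colspan (col_mx A C)]. Since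
    [dot x_l] sends [span(e_1, ..., e_n)] to the coordinate Lagrangian [I_{l,l}]
    ([cosetP_lift_x]), the orbit of [x_l] under [PJp] consists of points with
    [\rank C = l], and the orbit of [x_k] under [PJm] of points with
    [\rank A = n - k] ([rank_dsub_PJp], [rank_usub_PJm]).

    Conversely, a pair [(A, C)] with [A^T *m C] positive semi-definite and no
    common kernel is determined by the two ranks, up to column operations and
    the action of [LJo] ([lagrangian_normal_form]). Gaussian elimination turns
    [A] into a coordinate projection. Symmetry of [A^T *m C] then makes [C]
    block lower triangular, with a positive semi-definite upper left block, and
    absence of a common kernel makes its lower right block invertible. Column
    operations reduce the lower row of blocks to [(0, 1)], and a congruence of
    the upper left block ([psd_congr_Im], completion of squares) turns it into
    a 0/1 diagonal matrix with its ones at the end. This is [I_{k,l}], and the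
    sign of the determinant can be corrected by flipping one coordinate.

    That [LJo] maps [I_{k,l}] into both orbits is seen from two explicit
    symplectic shears. *)

(** * Normal form of a positive semi-definite Lagrangian pair *)

(* [Im] and [cosetP] also name the imaginary part and a lemma on quotient
   groups. *)
Local Notation Im := Defs.Im.
Local Notation cosetP := Defs.cosetP.

Section PositiveSemidefinite.
Variable R : realType.

Lemma psd_congr n (S T : 'M[R]_n) : psd S -> psd (T^T *m S *m T).
Proof.
case=> sS pS; split; first by rewrite !trmx_mul trmxK sS mulmxA.
by move=> x; have := pS (T *m x); rewrite trmx_mul !mulmxA.
Qed.

Lemma psd_ulsub m n (S : 'M[R]_(m + n)) : psd S -> psd (ulsubmx S).
Proof.
case=> sS pS; split; first by rewrite trmx_ulsub sS.
move=> x; have := pS (col_mx x 0).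
rewrite -{1}[S]submxK tr_col_mx mul_row_block mul_row_col.
by rewrite !trmx0 !mul0mx !mulmx0 !addr0.
Qed.

Lemma psd_diag_mx n (d : 'rV[R]_n) : (forall i, 0 <= d 0 i) -> psd (diag_mx d).
Proof.
move=> d0; split; first by rewrite tr_diag_mx.
move=> x; rewrite mxE; apply: sumr_ge0 => i _.
by rewrite mul_mx_diag !mxE mulrAC mulr_ge0 // -expr2 sqr_ge0.
Qed.

Lemma psd_diag_ge0 n (S : 'M[R]_n) i : psd S -> 0 <= S i i.
Proof.
case=> _ /(_ (delta_mx i 0)).
by rewrite trmx_delta -rowE -colE !mxE.
Qed.

Lemma psd_diag0 n (S : 'M[R]_n) : psd S -> (forall i, S i i = 0) -> S = 0.
Proof.
case=> sS pS d0; apply/matrixP => i j; rewrite [RHS]mxE.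
have Sji : S j i = S i j by rewrite -{1}sS mxE.
(* The form takes the value [- 2 * S i j ^ 2] at [e_i - S i j *: e_j]. *)
have := pS (delta_mx i 0 - S i j *: delta_mx j 0).
have -> : (delta_mx i 0 - S i j *: delta_mx j 0 : 'cV_n)^T
    = delta_mx 0 i - S i j *: delta_mx 0 j.
  by rewrite [LHS]linearB linearZ /= !trmx_delta.
rewrite mulmxBl -scalemxAl -!rowE.
rewrite mulmxBr !mulmxBl -!scalemxAr -!scalemxAl -!colE !mxE !d0 Sji.
rewrite !mulr0 subr0 sub0r -opprD oppr_ge0 => h.
have s0 : 0 <= S i j * S i j by rewrite -expr2 sqr_ge0.
apply/eqP; rewrite -sqrf_eq0 expr2 eq_le s0 andbT.
by apply: le_trans h; rewrite lerDl.
Qed.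

Lemma Im_block r m k : block_mx (Im R r m) 0 0 1%:M = Im R (r + k) (m + k).
Proof.
apply/matrixP => i j.
case: (split_ordP i) => a ->; case: (split_ordP j) => b ->;
  rewrite ?block_mxEul ?block_mxEur ?block_mxEdl ?block_mxEdr !mxE
    ?eq_lrshift ?eq_rlshift ?eq_rshift ?eq_lshift ?mulr0n //= subnDr //.
by have -> : (r - m <= r + a)%N by lia.
Qed.

Lemma Ip_block r k : Ip R (r + k) r = block_mx 1%:M 0 0 0.
Proof.
apply/matrixP => i j.
case: (split_ordP i) => a ->; case: (split_ordP j) => b ->;
  rewrite ?block_mxEul ?block_mxEur ?block_mxEdl ?block_mxEdr !mxE
    ?eq_lrshift ?eq_rlshift ?eq_rshift ?eq_lshift ?mulr0n //=.
  by rewrite ltn_ord.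
by rewrite ltnNge leq_addr mul0rn.
Qed.

(** Completing the square with respect to the last coordinate. *)
Lemma psd_complete_square n (S : 'M[R]_(n + 1)) :
    psd S -> S (rshift n 0) (rshift n 0) != 0 ->
  exists S' V, V \in unitmx /\ V^T *m S *m V = block_mx S' 0 0 (1%:M : 'M_1).
Proof.
move=> pS; set a := S _ _ => a0.
have {a0}a_gt0 : 0 < a by rewrite lt_def a0 psd_diag_ge0.
have cE : drsubmx S = a%:M.
  by apply/matrixP => x y; rewrite !ord1 [LHS]mxE [LHS]mxE !mxE eqxx.
pose b := ursubmx S.
have SE : S = block_mx (ulsubmx S) b b^T a%:M.
  by rewrite -cE /b trmx_ursub (proj1 pS) submxK.
pose q := (Num.sqrt a)^-1.
have q0 : q != 0 by rewrite invr_eq0 gt_eqF // sqrtr_gt0.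
have qaq : q * a * q = 1.
  rewrite -[X in _ * X * _](sqr_sqrtr (ltW a_gt0)) expr2 /q mulrA.
  by rewrite mulVf ?mul1r ?divff // gt_eqF // sqrtr_gt0.
have aV : a * - a^-1 = -1 by rewrite mulrN divff // gt_eqF.
pose V : 'M[R]_(n + 1) := block_mx 1%:M 0 (- a^-1 *: b^T) q%:M.
exists (ulsubmx S + - a^-1 *: (b *m b^T)), V; split.
  by rewrite unitmxE det_lblock det1 mul1r det_scalar expr1 unitfE.
rewrite [in LHS]SE /V tr_block_mx !mulmx_block.
rewrite !linearZ /= !trmxK !trmx0 !trmx1 !tr_scalar_mx.
rewrite !(mul0mx, mulmx0, mul1mx, mulmx1, add0r, addr0).
rewrite !mul_mx_scalar !mul_scalar_mx !scalerA.
rewrite aV scaleN1r subrr mul0mx !scaler0 addr0.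
rewrite -!scalemxAl mul_scalar_mx !scalerA [- a^-1 * _]mulrC aV.
by rewrite mulN1r (scaleNr q) subrr scale_scalar_mx qaq.
Qed.

(** A positive semi-definite matrix is congruent to a 0/1 diagonal matrix with
    the ones at the end. *)
Lemma psd_congr_Im n (S : 'M[R]_n) : psd S ->
  exists m (T : 'M[R]_n), [/\ (m <= n)%N, T \in unitmx & T^T *m S *m T = Im R n m].
Proof.
elim: n S => [|n IH] S pS.
  by exists 0%N, 1%:M; split; rewrite ?unitmx1 //; apply/matrixP => -[].
case: (boolP [forall i, S i i == 0]) => [/forallP h|].
  have -> : S = 0 by apply: psd_diag0 => // i; apply/eqP.
  exists 0%N, 1%:M; split; rewrite ?unitmx1 // mulmx0 mul0mx.
  apply/matrixP => i j; rewrite !mxE subn0 leqNgt ltn_ord.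
  by rewrite mul0rn.
rewrite negb_forall => /existsP[i Sii].
move: S pS i Sii; rewrite -[n.+1]addn1 => S pS i Sii.
(* The nonzero diagonal entry is moved to the last position. *)
pose s := tperm i (rshift n 0).
have uV : perm_mx s \in @unitmx R _ by apply: unitmx_perm.
have pS1 := psd_congr (perm_mx s) pS.
have [|S2 [V2 [uV2 V2E]]] := psd_complete_square pS1.
  rewrite tr_perm_mx tpermV -row_permE -[s in _ *m perm_mx s]tpermV -col_permE.
  by rewrite !mxE tpermR.
have pS2 : psd S2.
  by have := psd_ulsub (psd_congr V2 pS1); rewrite V2E block_mxKul.
have [m [T [lemn uT TE]]] := IH _ pS2.
exists (m + 1)%N, (perm_mx s *m V2 *m block_mx T 0 0 1%:M); split.
- by rewrite leq_add2r.
- by rewrite !unitmx_mul uV uV2 unitmxE det_ublock det1 mulr1 -unitmxE.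
transitivity ((block_mx T 0 0 1%:M)^T *m
    (V2^T *m ((perm_mx s)^T *m S *m perm_mx s) *m V2) *m block_mx T 0 0 (1%:M : 'M_1)).
  by rewrite !trmx_mul !mulmxA.
rewrite V2E tr_block_mx !mulmx_block !trmx0 trmx1.
rewrite !(mul0mx, mulmx0, mul1mx, mulmx1, add0r, addr0).
by rewrite TE Im_block.
Qed.

Lemma rank_Im n l : (l <= n)%N -> \rank (Im R n l) = l.
Proof.
move=> lel; have [r ->] : exists r, n = (r + l)%N by exists (n - l)%N; lia.
rewrite -[l in Im _ _ l]add0n -Im_block.
have -> : Im R r 0 = 0.
  by apply/matrixP => i j; rewrite !mxE subn0 leqNgt ltn_ord mul0rn.
by rewrite rank_diag_block_mx mxrank0 mxrank1.
Qed.

Lemma rank_Ip n r : (r <= n)%N -> \rank (Ip R n r) = r.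
Proof.
move=> len; have [k ->] : exists k, n = (r + k)%N by exists (n - r)%N; lia.
by rewrite Ip_block rank_diag_block_mx mxrank0 mxrank1 addn0.
Qed.

(** The case where the first block is already a coordinate projection: the
    lower block is then block lower triangular, with a positive semi-definite
    block followed by an invertible one. *)
Lemma lagrangian_normal_form_Ip r k (C : 'M[R]_(r + k)) :
    psd ((Ip R (r + k) r)^T *m C) ->
    (forall x : 'cV_(r + k), Ip R _ r *m x = 0 -> C *m x = 0 -> x = 0) ->
  exists l (D H : 'M[R]_(r + k)),
    [/\ (l <= r + k)%N, D \in unitmx, H \in unitmx,
        Ip R _ r *m H = D *m Ip R _ r & D^T *m C *m H = Im R _ l].
Proof.
rewrite Ip_block => pC injC.
set C11 := ulsubmx C; set C12 := ursubmx C.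
set C21 := dlsubmx C; set C22 := drsubmx C.
have CE : C = block_mx C11 C12 C21 C22 by rewrite submxK.
have PC : (block_mx 1%:M 0 0 0 : 'M[R]_(r + k))^T *m C = block_mx C11 C12 0 0.
  rewrite CE tr_block_mx mulmx_block !trmx0 trmx1.
  by rewrite !(mul0mx, mul1mx, add0r, addr0).
move: pC; rewrite PC => pC.
have C12_0 : C12 = 0.
  case: pC => sC _; move: sC; rewrite tr_block_mx => /eq_block_mx[_ + _ _].
  by rewrite trmx0 => <-.
have pC11 : psd C11 by have := psd_ulsub pC; rewrite block_mxKul.
have uC22 : C22 \in unitmx.
  rewrite -unitmx_tr -row_free_unit; apply: inj_row_free => v /(congr1 trmx).
  rewrite trmx_mul trmxK trmx0 => vC.
  have : col_mx 0 v^T = 0 :> 'cV_(r + k).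
    apply: injC; rewrite ?CE mul_block_col ?C12_0;
    by rewrite !(mul0mx, mulmx0, add0r, addr0) ?vC col_mx0.
  rewrite -col_mx0 => /eq_col_mx[_ /(congr1 trmx)].
  by rewrite trmxK trmx0.
have [m [T [lemr uT TE]]] := psd_congr_Im pC11.
exists (m + k)%N, (block_mx T 0 0 1%:M),
  (block_mx T 0 (- (invmx C22 *m C21 *m T)) (invmx C22)); split.
- by rewrite leq_add2r.
- by rewrite unitmxE det_ublock det1 mulr1 -unitmxE.
- by rewrite unitmxE det_lblock unitrM -!unitmxE uT unitmx_inv.
- by rewrite !mulmx_block !(mul0mx, mulmx0, mul1mx, mulmx1, add0r, addr0).
rewrite CE C12_0 tr_block_mx !mulmx_block !trmx0 trmx1.
rewrite !(mul0mx, mulmx0, mul1mx, mulmx1, add0r, addr0) TE.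
rewrite mulmxN !mulmxA mulmxV // mul1mx subrr.
by rewrite Im_block.
Qed.

(** If [A] and [C] are the blocks of a point of the nonnegative Lagrangian
    Grassmannian, then up to column operations [H] and the action of [D] they
    depend only on their ranks. *)
Lemma lagrangian_normal_form n (A C : 'M[R]_n) :
    psd (A^T *m C) ->
    (forall x : 'cV_n, A *m x = 0 -> C *m x = 0 -> x = 0) ->
  exists D H : 'M[R]_n,
    [/\ 0 < \det D, H \in unitmx,
        A *m H = D *m Ip R n (\rank A) & D^T *m C *m H = Im R n (\rank C)].
Proof.
move=> pAC injAC.
suff [D [H [uD uH HE DE]]] : exists D H : 'M[R]_n,
    [/\ D \in unitmx, H \in unitmx,
        A *m H = D *m Ip R n (\rank A) & D^T *m C *m H = Im R n (\rank C)].
  have [D_gt0|D_le0] := ltP 0 (\det D); first by exists D, H.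
  (* Flipping one sign in both [D] and [H] makes the determinant positive. *)
  case: n => [|n] in A C pAC injAC D H uD uH HE DE D_le0 *.
    by move: D_le0; rewrite det_mx00 ler10.
  pose s : 'rV[R]_n.+1 := \row_i (-1) ^+ (i == 0).
  have ss : diag_mx s *m diag_mx s = 1%:M.
    rewrite mulmx_diag -diag_const_mx; congr diag_mx; apply/rowP => i.
    by rewrite !mxE -expr2 sqrr_sign.
  have us : diag_mx s \in unitmx by case/mulmx1_unit: ss.
  exists (D *m diag_mx s), (H *m diag_mx s); split.
  - rewrite det_mulmx det_diag (bigD1 ord0) //= big1 => [|i /negPf i0].
      rewrite mxE eqxx expr1 mulr1 mulrN1 oppr_gt0 lt_neqAle D_le0 andbT.
      by rewrite -unitfE -unitmxE.
    by rewrite mxE i0.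
  - by rewrite unitmx_mul uH.
  - by rewrite mulmxA HE -!mulmxA; congr (_ *m _); apply: diag_mxC.
  rewrite trmx_mul tr_diag_mx !mulmxA -(mulmxA _ D^T) -(mulmxA _ _ H) DE.
  by rewrite diag_mxC -mulmxA ss mulmx1.
set L := col_ebase A; set U := row_ebase A.
have uL : L \in unitmx by apply: col_ebase_unit.
have uU : U \in unitmx by apply: row_ebase_unit.
have AE : A *m invmx U = L *m Ip R n (\rank A).
  rewrite -{1}[A]mulmx_ebase mulmxK //; congr (_ *m _).
  apply/matrixP => i j; rewrite !mxE -(inj_eq val_inj).
  by case: eqP => //=; rewrite ?mulr0n ?mulr1n.
set C1 := L^T *m C *m invmx U.
have [l [D [H [ln uD uH HE DE]]]] : exists l (D H : 'M[R]_n),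
    [/\ (l <= n)%N, D \in unitmx, H \in unitmx,
        Ip R n (\rank A) *m H = D *m Ip R n (\rank A) & D^T *m C1 *m H = Im R n l].
  have pC1 : psd ((Ip R n (\rank A))^T *m C1).
    rewrite /C1 !mulmxA -trmx_mul -AE trmx_mul -(mulmxA _ A^T).
    exact: psd_congr.
  have injC1 (x : 'cV_n) : Ip R n (\rank A) *m x = 0 -> C1 *m x = 0 -> x = 0.
    move=> Ax Cx.
    have : invmx U *m x = 0.
      apply: injAC; first by rewrite mulmxA AE -mulmxA Ax mulmx0.
      apply: (can_inj (mulKmx (_ : L^T \in unitmx))); rewrite ?unitmx_tr //.
      by rewrite !mulmxA mulmx0.
    by move/(congr1 (mulmx U)); rewrite mulKVmx ?mulmx0.
  have rn := rank_leq_row A.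
  have [k nE] : exists k, n = (\rank A + k)%N by exists (n - \rank A)%N; lia.
  move: (\rank A) nE {AE rn} C1 pC1 injC1 => r nE.
  clear -nE; subst n; exact: lagrangian_normal_form_Ip.
have CE : (L *m D)^T *m C *m (invmx U *m H) = Im R n l.
  by rewrite -DE /C1 trmx_mul !mulmxA.
have rC : \rank C = l.
  rewrite -[RHS](rank_Im ln) -CE mxrankMfree.
    rewrite -[RHS]mxrank_tr trmx_mul mxrankMfree ?mxrank_tr //.
    by rewrite row_free_unit trmxK unitmx_mul uL.
  by rewrite row_free_unit unitmx_mul unitmx_inv uU.
exists (L *m D), (invmx U *m H); split.
- by rewrite unitmx_mul uL.
- by rewrite unitmx_mul unitmx_inv uU.
- by rewrite mulmxA AE -!mulmxA HE.
- by rewrite rC.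
Qed.

End PositiveSemidefinite.

(** * The coordinate subspace attached to a minimal coset representative *)

Section CosetRepresentatives.
Variable n : nat.

(** The set [{1, ..., n - l} `|` {-(n - l + 1), ..., -n}]. *)
Definition xset (l : nat) : pred 'I_(n + n) := fun p =>
  match split p with inl a => (a < n - l)%N | inr a => (n - l <= a)%N end.

(** The image of [xset l] under the partial product [s_{j-1} ... s_{n-l}], which
    moves [n - l] to [j] and lowers [n - l + 1, ..., j] by one, and acts likewise
    on their opposites. *)
Definition xset_step (l j : nat) : pred 'I_(n + n) := fun p =>
  match split p with
  | inl a => (a < n - l.+1)%N || (a.+1 == j)
  | inr a => (n - l.+1 <= a)%N && (a.+1 != j)
  end.

Lemma s_E (j : nat) (hj : (j.-1 < n)%N) (hj' : (j < n)%N) : (0 < j)%N ->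
  let s := tperm (Ordinal hj) (Ordinal hj') in
  forall a, (s_ n j (lshift n a) = lshift n (s a)) *
            (s_ n j (rshift n a) = rshift n (s a)).
Proof.
move=> j0 s a; rewrite /s_ !insubT !permM.
have sl := inj_tperm _ _ _ (@lshift_inj n n).
have sr := inj_tperm _ _ _ (@rshift_inj n n).
split.
  by rewrite -sl [LHS]tpermD ?eq_rlshift.
by rewrite [tperm (lshift _ _) _ _]tpermD ?eq_lrshift // -sr.
Qed.

Lemma xset_step_s l j p : (l < n)%N -> (n - l <= j < n)%N ->
  xset_step l j.+1 (s_ n j p) = xset_step l j p.
Proof.
move=> ln /andP[lj jn].
have j0 : (0 < j)%N by lia.
have j1n : (j.-1 < n)%N by lia.
rewrite /xset_step; case: (split_ordP p) => a ->; rewrite (s_E j1n jn) //.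
  rewrite (unsplitK (inl _)).
  by case: tpermP => [->|->|/eqP + /eqP]; rewrite -?(inj_eq val_inj) /=; lia.
rewrite (unsplitK (inr _)).
by case: tpermP => [->|->|/eqP + /eqP]; rewrite -?(inj_eq val_inj) /=; lia.
Qed.

Lemma xset_step_prod l j p : (l < n)%N -> (n - l <= j <= n)%N ->
  xset_step l j ((\prod_(n - l <= i < j) s_ n i)%g p) = xset l p.
Proof.
move=> ln; elim: j => [|j IH] /andP[lj jn]; first by lia.
have [ltj|gej] := ltnP j (n - l).
  rewrite big_geq ?perm1; last by lia.
  by rewrite /xset_step /xset; case: (split_ordP p) => a _; lia.
rewrite big_nat_recr //= permM xset_step_s ?gej ?IH //; lia.
Qed.

Lemma xset_t l p : (l < n)%N -> xset l.+1 (t_ n p) = xset_step l n p.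
Proof.
move=> ln; have n1 : (n.-1 < n)%N by lia.
rewrite /t_ insubT /xset /xset_step.
case: tpermP => [->|->|/eqP + /eqP].
- by rewrite (unsplitK (inl _)) (unsplitK (inr _)) /=; lia.
- by rewrite (unsplitK (inl _)) (unsplitK (inr _)) /=; lia.
case: (split_ordP p) => a ->;
  rewrite ?eq_lrshift ?eq_rlshift ?eq_rshift ?eq_lshift -?(inj_eq val_inj) /=.
  by have := ltn_ord a; lia.
by have := ltn_ord a; lia.
Qed.

(** The element [x_l] sends [{1, ..., n}] onto [xset l]. *)
Lemma xset_x l i : (l <= n)%N -> xset l (x_ n l i) = (i < n)%N.
Proof.
elim: l i => [|l IH] i ln.
  by rewrite perm1 /xset; case: (split_ordP i) => a _; have := ltn_ord a; lia.
by rewrite /= !permM xset_t // xset_step_prod ?IH ?leq_subr ?leqnn //; lia.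
Qed.

End CosetRepresentatives.

(** * Subspaces spanned by columns and the action of matrices *)

Section ColumnSpans.
Variables (R : realType) (n : nat).

Lemma mulmx_sum_col m (M : 'M[R]_(n + n, m)) y :
  M *m y = \sum_j y j 0 *: col j M.
Proof.
apply/colP => i; rewrite summxE mxE; apply: eq_bigr => j _.
by rewrite !mxE mulrC.
Qed.

Lemma colspan_tuple m (M : 'M[R]_(n + n, m)) :
  colspan M = <<[tuple col j M | j < m]>>%VS.
Proof. by []. Qed.

Lemma colspanP m (M : 'M[R]_(n + n, m)) u :
  reflect (exists y, u = M *m y) (u \in colspan M).
Proof.
apply: (iffP idP) => [|[y ->]]; last first.
  rewrite mulmx_sum_col; apply: memv_suml => j _; apply: memvZ; apply: memv_span.
  by apply/mapP; exists j; rewrite ?mem_enum.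
rewrite colspan_tuple => /coord_span ->.
exists (\col_j coord [tuple col j M | j < m] j u); rewrite mulmx_sum_col.
by apply: eq_bigr => j _; rewrite nth_mktuple mxE.
Qed.

Lemma actLG_colspan m (g : 'M[R]_(n + n)) (M : 'M[R]_(n + n, m)) :
  actLG g (colspan M) = colspan (g *m M).
Proof.
apply/vspaceP => u; apply/memv_imgP/colspanP => [[v /colspanP[y ->] ->]|[y ->]].
  by exists y; rewrite lfunE /= mulmxA.
exists (M *m y); first by apply/colspanP; exists y.
by rewrite lfunE /= mulmxA.
Qed.

Lemma sub_colspan m p (M : 'M[R]_(n + n, m)) (N : 'M[R]_(n + n, p)) :
  (colspan M <= colspan N)%VS <-> exists H, M = N *m H.
Proof.
split=> [/subvP MN|[H ->]].
  have /fin_all_exists[h hE] : forall j, exists y, col j M = N *m y.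
    move=> j; apply/colspanP/MN/colspanP.
    by exists (delta_mx j 0); rewrite colE.
  exists (\matrix_(i, j) h j i 0); apply/matrixP => i j.
  have /colP/(_ i) := hE j; rewrite !mxE => ->.
  by apply: eq_bigr => q _; rewrite !mxE.
apply/subvP => u /colspanP[y ->]; apply/colspanP.
by exists (H *m y); rewrite mulmxA.
Qed.

Lemma colspan_mulr m (M : 'M[R]_(n + n, m)) (H : 'M[R]_m) :
  H \in unitmx -> colspan (M *m H) = colspan M.
Proof.
move=> uH; apply/eqP; rewrite eqEsubv; apply/andP; split; apply/sub_colspan.
  by exists H.
by exists (invmx H); rewrite mulmxK.
Qed.

Lemma rank_colspan_le m p q (M : 'M[R]_(n + n, m)) (N : 'M[R]_(n + n, p))
    (X : 'M[R]_(q, n + n)) :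
  (colspan M <= colspan N)%VS -> (\rank (X *m M) <= \rank (X *m N))%N.
Proof. by case/sub_colspan => H ->; rewrite mulmxA mxrankM_maxl. Qed.

Lemma rank_colspan_eq m p q (M : 'M[R]_(n + n, m)) (N : 'M[R]_(n + n, p))
    (X : 'M[R]_(q, n + n)) :
  colspan M = colspan N -> \rank (X *m M) = \rank (X *m N).
Proof. by move=> MN; apply/eqP; rewrite eqn_leq !rank_colspan_le ?MN. Qed.

Lemma dim_colspanP m (M : 'M[R]_(n + n, m)) :
  \dim (colspan M) = m <-> forall y : 'cV_m, M *m y = 0 -> y = 0.
Proof.
have E : (\dim (colspan M) == m) = free [tuple col j M | j < m].
  by rewrite colspan_tuple /free size_tuple.
split=> [/eqP|inj].
  rewrite E => /freeP fM y; rewrite mulmx_sum_col => My.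
  apply/colP => j; rewrite mxE; apply: (fM (fun j => y j 0)).
  by rewrite -[RHS]My; apply: eq_bigr => i _; rewrite nth_mktuple.
apply/eqP; rewrite E; apply/freeP => c cM j.
have /colP/(_ j) : \col_i c i = 0 :> 'cV[R]_m.
  apply: inj; rewrite mulmx_sum_col -[RHS]cM; apply: eq_bigr => i _.
  by rewrite nth_mktuple mxE.
by rewrite !mxE.
Qed.

Lemma cosetP_mul (p g : 'M[R]_(n + n)) : cosetP (p *m g) = actLG p (cosetP g).
Proof. by rewrite /cosetP !actLG_colspan mulmxA. Qed.

(** Column [j] of [I_{l,l}] is the standard basis vector of index [idx l j]. *)
Let idx (l : nat) (j : 'I_n) : 'I_(n + n) :=
  if (j < n - l)%N then lshift n j else rshift n j.

Let col_Ikl l j : (l <= n)%N ->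
  col j (col_mx (Ip R n (n - l)) (Im R n l)) = delta_mx (idx l j) 0.
Proof.
move=> ln; apply/colP => i; rewrite /idx.
case: (split_ordP i) => a ->; case: ltnP => h; rewrite !mxE.
- rewrite (unsplitK (inl _)) !mxE eq_lshift eqxx andbT.
  by case: (eqVneq a j) => [->|]; rewrite ?h ?mulr0n.
- rewrite (unsplitK (inl _)) !mxE eq_lrshift.
  by case: (eqVneq a j) => [->|]; rewrite ?mulr0n // ltnNge h.
- rewrite (unsplitK (inr _)) !mxE eq_rlshift.
  by case: (eqVneq a j) => [->|]; rewrite ?mulr0n // leqNgt h.
rewrite (unsplitK (inr _)) !mxE eq_rshift eqxx andbT.
by case: (eqVneq a j) => [->|]; rewrite ?h ?mulr0n.
Qed.

Let xset_idx l p : xset l p -> exists j, p = idx l j.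
Proof.
rewrite /xset /idx; case: (split_ordP p) => j -> h; exists j; first by rewrite h.
by rewrite ltnNge h.
Qed.

Let idx_xset l j : xset l (idx l j).
Proof.
rewrite /idx; case: ltnP => h; rewrite /xset.
  by rewrite (unsplitK (inl _)).
by rewrite (unsplitK (inr _)).
Qed.

(** A lift of [x_l] sends [span(e_1, ..., e_n)] to [I_{l,l}]. *)
Lemma cosetP_lift_x l (g : 'M[R]_(n + n)) :
  (l <= n)%N -> lift_of (x_ n l) g -> cosetP g = Ikl R n l l.
Proof.
move=> ln [_ gE].
rewrite /cosetP actLG_colspan -{1}[g]hsubmxK mul_row_col mulmx1 mulmx0 addr0.
have colg a : col a (lsubmx g) = col (lshift n a) g.
  by apply/colP => i; rewrite !mxE.
have mem_col m (M : 'M[R]_(n + n, m)) i : col i M \in colspan M.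
  by apply/colspanP; exists (delta_mx i 0); rewrite colE.
apply/eqP; rewrite eqEsubv; apply/andP; split; apply/span_subvP => u /mapP[j _ ->].
  rewrite colg; have [b ->] := gE (lshift n j); apply: memvZ.
  have /xset_idx[i ->] : xset l (x_ n l (lshift n j)) by rewrite xset_x /=.
  by rewrite -col_Ikl // mem_col.
set i := (x_ n l)^-1%g (idx l j).
have xi : x_ n l i = idx l j by rewrite permKV.
have := xset_x i ln; have := gE i; rewrite xi idx_xset.
case: (split_ordP i) => a -> // [b] + _.
rewrite col_Ikl // -colg => /(congr1 (GRing.scale ((-1) ^+ b))).
rewrite scalerA -expr2 sqrr_sign scale1r => <-.
exact/memvZ/mem_col.
Qed.

End ColumnSpans.

(** * Symplectic block matrices and the theorem *)

Section SymplecticBlocks.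
Variables (R : realType) (n : nat).
Implicit Types a b c d : 'M[R]_n.

Lemma Sp_block a b c d : Sp (block_mx a b c d) <->
  [/\ a^T *m c = c^T *m a, b^T *m d = d^T *m b & a^T *m d - c^T *m b = 1%:M].
Proof.
rewrite /Sp /= /J tr_block_mx !mulmx_block.
rewrite !(mulmx0, mulmx1, add0r, addr0, mulmxN, mulNmx).
split=> [/eq_block_mx[e1 e2 _ e4]|[e1 e2 e3]].
  split; last by rewrite addrC.
    by apply/eqP; rewrite -subr_eq0 addrC e1.
  by apply/eqP; rewrite -subr_eq0 addrC e4.
congr block_mx.
- by rewrite e1 addrC subrr.
- by rewrite addrC.
- move/(congr1 trmx): e3; rewrite linearB /= !trmx_mul !trmxK trmx1 => <-.
  by rewrite opprB addrC.
by rewrite e2 addNr.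
Qed.

Lemma Sp_mul (g h : 'M[R]_(n + n)) : Sp g -> Sp h -> Sp (g *m h).
Proof.
rewrite /Sp /= => gJ hJ.
transitivity (h^T *m (g^T *m J R n *m g) *m h); last by rewrite gJ.
by rewrite trmx_mul !mulmxA.
Qed.

Lemma LGr_cosetP (g : 'M[R]_(n + n)) : Sp g -> LGr R n (cosetP g).
Proof.
rewrite /Sp /= => gJ; split.
  rewrite /cosetP actLG_colspan; apply/dim_colspanP => y gy.
  have : J R n *m (col_mx 1%:M 0 *m y) = 0.
    by rewrite -gJ -!mulmxA (mulmxA g) gy !mulmx0.
  rewrite [col_mx _ _ *m y]mul_col_mx mul1mx mul0mx /J mul_block_col.
  rewrite !(mul0mx, mulmx0, add0r, addr0) -col_mx0 => /eq_col_mx[_].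
  by rewrite mulNmx mul1mx => /eqP; rewrite oppr_eq0 => /eqP.
move=> u v; rewrite /cosetP actLG_colspan => /colspanP[y ->] /colspanP[z ->].
rewrite !trmx_mul !mulmxA -(mulmxA _ g^T) -(mulmxA _ _ g) gJ.
rewrite tr_col_mx trmx0 trmx1 -(mulmxA y^T) /J mul_row_block.
rewrite !(mul0mx, mulmx0, add0r, addr0, mulmx1) -(mulmxA y^T) mul_row_col.
by rewrite !(mul0mx, mulmx0, add0r, addr0, mulmx1).
Qed.

(** Points of the [PJp]-orbit of [x_l] have a lower block of rank [l]. *)
Lemma rank_dsub_PJp l (p g : 'M[R]_(n + n)) (A C : 'M[R]_n) :
    (l <= n)%N -> PJp p -> lift_of (x_ n l) g ->
  colspan (col_mx A C) = cosetP (p *m g) -> \rank C = l.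
Proof.
move=> ln [Sp_p p0] gx; rewrite cosetP_mul (cosetP_lift_x ln gx) /Ikl.
rewrite actLG_colspan => /(rank_colspan_eq (row_mx 0 1%:M)).
rewrite mul_row_col mul0mx mul1mx add0r => ->.
move: Sp_p; rewrite -[p in Sp p]submxK p0 => /Sp_block[_ _].
rewrite trmx0 mul0mx subr0 => /mulmx1_unit[_ ud].
rewrite -[p]submxK p0 mul_block_col mul_row_col !mul0mx mul1mx !add0r.
by rewrite -mxrank_tr trmx_mul mxrankMfree ?mxrank_tr ?rank_Im //
  row_free_unit unitmx_tr.
Qed.

(** Points of the [PJm]-orbit of [x_k] have an upper block of corank [k]. *)
Lemma rank_usub_PJm k (p g : 'M[R]_(n + n)) (A C : 'M[R]_n) :
    (k <= n)%N -> PJm p -> lift_of (x_ n k) g ->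
  colspan (col_mx A C) = cosetP (p *m g) -> \rank A = (n - k)%N.
Proof.
move=> kn [Sp_p p0] gx; rewrite cosetP_mul (cosetP_lift_x kn gx) /Ikl.
rewrite actLG_colspan => /(rank_colspan_eq (row_mx 1%:M 0)).
rewrite mul_row_col mul0mx mul1mx addr0 => ->.
move: Sp_p; rewrite -[p in Sp p]submxK p0 => /Sp_block[_ _].
rewrite mulmx0 subr0 => /mulmx1_unit[ua _].
rewrite -[p]submxK p0 mul_block_col mul_row_col !mul0mx mul1mx !addr0.
by rewrite -mxrank_tr trmx_mul mxrankMfree ?mxrank_tr ?rank_Ip ?leq_subr //
  row_free_unit.
Qed.

End SymplecticBlocks.

Theorem theorem5p7 (R : realType) (n k l : nat)
    (hn : (1 <= n)%N) (hkl : (k <= l)%N) (hln : (l <= n)%N)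
    (dxk dxl : 'M[R]_(n + n))
    (hdxk : lift_of (x_ n k) dxk) (hdxl : lift_of (x_ n l) dxl) :
  [set actLG g (Ikl R n k l) | g in LJo R n] = LGr_ge0 R n `&` Rtilde dxk dxl.
Proof.
have hkn := leq_trans hkl hln.
apply/seteqP; split=> [_ [g [D /= D_gt0 <-] <-]|U [[[dimU _] [A [C [UE pAC]]]]]]; last first.
  move=> [[p Pp pU] [q Pq qU]].
  have rC : \rank C = l by apply: (rank_dsub_PJp (A := A) hln Pp hdxl); rewrite -UE pU.
  have rA : \rank A = (n - k)%N by apply: (rank_usub_PJm (C := C) hkn Pq hdxk); rewrite -UE qU.
  have injAC (x : 'cV_n) : A *m x = 0 -> C *m x = 0 -> x = 0.
    move=> Ax Cx; move: dimU; rewrite UE => /dim_colspanP; apply.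
    by rewrite mul_col_mx Ax Cx col_mx0.
  have [D [H [D_gt0 uH]]] := lagrangian_normal_form pAC injAC.
  rewrite rA rC => AH CH.
  have uD : D^T \in unitmx by rewrite unitmx_tr unitmxE unitfE gt_eqF.
  exists (block_mx D 0 0 (invmx D^T)); first by exists D.
  rewrite /Ikl actLG_colspan mul_block_col !mul0mx addr0 add0r -AH -CH.
  by rewrite -mulmxA mulKmx // -mul_col_mx colspan_mulr // UE.
set E := invmx D^T.
have DE : D^T *m E = 1%:M by rewrite mulmxV // unitmx_tr unitmxE unitfE gt_eqF.
have ED : E^T *m D = 1%:M by rewrite -[D]trmxK -trmx_mul DE trmx1.
(* The diagonal matrix of the positions where the ones of both blocks of
   [I_{k,l}] meet; the shears defined by [B] take [I_{l,l}] and [I_{k,k}] to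
   [I_{k,l}]. *)
pose B : 'M[R]_n := diag_mx (\row_(i < n) ((n - l <= i) && (i < n - k))%N%:R).
have trB : B^T = B by rewrite tr_diag_mx.
have pE : Ip R n (n - l) + B *m Im R n l = Ip R n (n - k).
  rewrite mulmx_diag -raddfD; congr diag_mx; apply/rowP => i; rewrite !mxE.
  rewrite -natrM -natrD; congr _%:R.
  by case: ltnP; case: ltnP => //=; lia.
have qE : B *m Ip R n (n - k) + Im R n k = Im R n l.
  rewrite mulmx_diag -raddfD; congr diag_mx; apply/rowP => i; rewrite !mxE.
  rewrite -natrM -natrD; congr _%:R.
  by case: ltnP; case: ltnP => //=; lia.
rewrite /Ikl actLG_colspan mul_block_col !mul0mx addr0 add0r.
set U := colspan _.
pose p : 'M[R]_(n + n) := block_mx D (D *m B) 0 E.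
pose q : 'M[R]_(n + n) := block_mx D 0 (E *m B) E.
have Sp_p : Sp p.
  apply/Sp_block; split; rewrite ?trmx0 ?mulmx0 ?mul0mx ?subr0 //.
  by rewrite trmx_mul trB -mulmxA DE mulmxA ED mul1mx mulmx1.
have Sp_q : Sp q.
  apply/Sp_block; split; rewrite ?trmx0 ?mulmx0 ?mul0mx ?subr0 //.
  by rewrite trmx_mul trB -mulmxA ED mulmxA DE mul1mx mulmx1.
have pU : cosetP (p *m dxl) = U.
  rewrite cosetP_mul (cosetP_lift_x hln hdxl) /Ikl actLG_colspan.
  by rewrite mul_block_col mul0mx add0r -mulmxA -mulmxDr pE.
have qU : cosetP (q *m dxk) = U.
  rewrite cosetP_mul (cosetP_lift_x hkn hdxk) /Ikl actLG_colspan.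
  by rewrite mul_block_col mul0mx addr0 -mulmxA -mulmxDr qE.
split; last first.
  split; [exists p|exists q] => //; split => //; first by rewrite block_mxKdl.
  by rewrite block_mxKur.
split.
  by rewrite -/U -pU; apply: LGr_cosetP; apply: Sp_mul => //; case: hdxl.
exists (D *m Ip R n (n - k)), (E *m Im R n l); split=> //.
rewrite trmx_mul mulmxA -(mulmxA _ D^T) DE mulmx1 tr_diag_mx mulmx_diag.
by apply: psd_diag_mx => i; rewrite !mxE mulr_ge0 // ler0n.
Qed.
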